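(* Let $A$ and $B$ be $C^*$-algebras. If $T:A\to B$ is a Jordan $^*$-homomorphism, then for all regular elements $a,b\in A^\wedge$, $a\leq_\diamond b$ implies $T(a)\leq_\diamond T(b)$.
   Context: All algebras are complex. For elements $a,b$ of a $C^*$-algebra $A$, the diamond relation is defined by: $a\leq_\diamond b$ if and only if $aA\subseteq bA$, $Aa\subseteq Ab$ and $aa^*a=ab^*a$. $A^\wedge$ is the set of (von Neumann) regular elements of $A$, i.e. those $a\in A$ for which there is $c\in A$ with $a=aca$; in a $C^*$-algebra these are exactly the elements having a Moore-Penrose inverse. A linear map $T:A\to B$ is a Jordan $^*$-homomorphism if $T(a^2)=T(a)^2$ and $T(a^* )=T(a)^*$ for all $a\in A$. *)

(* Defs.v *)
From HB Require Import structures.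
From mathcomp Require Import all_boot all_order all_algebra.
From mathcomp Require Export complex.
From mathcomp Require Export boolp classical_sets reals topology normedtype.

Set Implicit Arguments.
Unset Strict Implicit.
Unset Printing Implicit Defensive.

Import Order.TTheory GRing.Theory Num.Theory.
Import numFieldNormedType.Exports.
Local Open Scope classical_set_scope.
Local Open Scope ring_scope.
Local Open Scope complex_scope.

Declare Scope cstar_scope.
Delimit Scope cstar_scope with CS.

(* C*-algebras are not assumed to be unital, whereas the ring and algebra
   structures of MathComp all have a multiplicative identity; hence the product
   is introduced here, on top of a Banach space over R[i].  The norm takes its
   values in R[i], where x <= y means that y - x is a nonnegative real. *)
HB.mixin Record isCStarAlgebra (R : realType) A
    of CompleteNormedModule R[i] A := {
  cstar_mul : A -> A -> A;
  cstar_adj : A -> A;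
  cstar_mulA : associative cstar_mul;
  cstar_mulDl : left_distributive cstar_mul +%R;
  cstar_mulDr : right_distributive cstar_mul +%R;
  cstar_scalerAl : forall (k : R[i]) (x y : A),
    k *: cstar_mul x y = cstar_mul (k *: x) y;
  cstar_scalerAr : forall (k : R[i]) (x y : A),
    k *: cstar_mul x y = cstar_mul x (k *: y);
  cstar_normM_le : forall x y : A, `|cstar_mul x y| <= `|x| * `|y|;
  cstar_adjK : involutive cstar_adj;
  cstar_adjD : {morph cstar_adj : x y / x + y};
  cstar_adjZ : forall (k : R[i]) (x : A),
    cstar_adj (k *: x) = k^* *: cstar_adj x;
  cstar_adjM : forall x y : A,
    cstar_adj (cstar_mul x y) = cstar_mul (cstar_adj y) (cstar_adj x);
  cstar_norm_adjM : forall x : A, `|cstar_mul (cstar_adj x) x| = `|x| ^+ 2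
}.

#[short(type="cstarAlgType")]
HB.structure Definition CStarAlgebra (R : realType) :=
  {A of CompleteNormedModule R[i] A & isCStarAlgebra R A}.

Notation "x * y" := (cstar_mul x y) : cstar_scope.
Notation "x ^*" := (cstar_adj x) : cstar_scope.

Section CStarNotions.
Context {R : realType}.
Implicit Types A B : cstarAlgType R.

Definition vN_regular A : set A := [set a | exists c : A, a = (a * c * a)%CS].

Definition diamond_le A (a b : A) : Prop :=
  [/\ [set (a * x)%CS | x in [set: A]] `<=` [set (b * x)%CS | x in [set: A]],
      [set (x * a)%CS | x in [set: A]] `<=` [set (x * b)%CS | x in [set: A]]
    & (a * a^* * a = a * b^* * a)%CS].

Definition jordan_star_homomorphism A B (T : {linear A -> B}) : Prop :=
  (forall a : A, T (a * a)%CS = (T a * T a)%CS) /\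
  (forall a : A, T (a^*)%CS = ((T a)^*)%CS).

End CStarNotions.

(* Main.v *)
(* Regularity [a = a c a] together with [a = b x = y b] gives
   [a = b (x c y) b].  A Jordan homomorphism preserves triple products
   [u v u], so it carries this identity, hence both inclusions, and the
   identity [a a^* a = a b^* a], to [B]. *)
Require Import Defs.
From mathcomp Require Import all_boot all_order all_algebra.

Set Implicit Arguments.
Unset Strict Implicit.
Unset Printing Implicit Defensive.

Import GRing.Theory Num.Theory.
Local Open Scope ring_scope.

Section CStarProduct.
Context {R : realType}.
Implicit Types A B : cstarAlgType R.

Lemma cstar_sqrD A (x y : A) :
  ((x + y) * (x + y))%CS =
  (x * x)%CS + ((x * y)%CS + (y * x)%CS) + (y * y)%CS.
Proof. by rewrite cstar_mulDl !cstar_mulDr !addrA. Qed.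

(** With [u o v = u v + v u], this is [x o (x o y) = 2 x y x + x^2 o y]: twice the triple product is
    expressed by Jordan products alone. *)
Lemma cstar_jordan_triple A (x y : A) :
  let xy := (x * y)%CS + (y * x)%CS in
  (x * xy)%CS + (xy * x)%CS =
  ((x * y * x)%CS + (x * y * x)%CS) + ((x * x * y)%CS + (y * (x * x))%CS).
Proof.
rewrite /= cstar_mulDl cstar_mulDr !cstar_mulA.
by rewrite [X in X + _ = _]addrC addrACA.
Qed.

(** Polarization: expand [T ((x + y)^2) = (T x + T y)^2] and cancel the squares. *)
Lemma jordan_mulD A B (T : {linear A -> B}) (x y : A) :
  (forall z : A, T (z * z)%CS = (T z * T z)%CS) ->
  T ((x * y)%CS + (y * x)%CS) = (T x * T y)%CS + (T y * T x)%CS.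
Proof.
move=> T_sqr; apply: (@addrI _ (T x * T x)%CS).
apply: (@addIr _ (T y * T y)%CS).
by rewrite -cstar_sqrD -linearD -!T_sqr -!linearD cstar_sqrD.
Qed.

Lemma jordan_triple A B (T : {linear A -> B}) (x y : A) :
  (forall z : A, T (z * z)%CS = (T z * T z)%CS) ->
  T (x * y * x)%CS = (T x * T y * T x)%CS.
Proof.
move=> T_sqr.
have T_double : T (x * y * x)%CS + T (x * y * x)%CS =
    (T x * T y * T x)%CS + (T x * T y * T x)%CS.
  (* Adding the Jordan product of [(T x)^2] and [T y] completes the right side to a nested Jordan
     product, through which [T] passes. *)
  apply: (@addIr _ ((T x * T x * T y)%CS + (T y * (T x * T x))%CS)).
  rewrite -cstar_jordan_triple -(jordan_mulD _ _ T_sqr).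
  rewrite -(jordan_mulD _ _ T_sqr) cstar_jordan_triple.
  by rewrite -T_sqr -(jordan_mulD _ _ T_sqr) -!linearD.
(* The factor 2 is cancelled as a nonzero complex scalar. *)
apply: (@scalerI _ _ (2%:R : R[i])); first by rewrite pnatr_eq0.
by rewrite !scaler_nat !mulr2n.
Qed.

Lemma regular_diamond_le_factor A (a b : A) :
  vN_regular a -> diamond_le a b -> exists w : A, a = (b * w * b)%CS.
Proof.
case=> c a_aca [aA_bA Aa_Ab _].
(* Without a unit, [a] lies in [aA] thanks to regularity: [a = a (c a)]. Likewise [a = (a c) a] lies
   in [Aa]. *)
have [x _ bx_a] : exists2 x, [set: A]%classic x & (b * x = a)%CS.
  by apply: aA_bA; exists (c * a)%CS; rewrite // cstar_mulA -a_aca.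
have [y _ yb_a] : exists2 y, [set: A]%classic y & (y * b = a)%CS.
  by apply: Aa_Ab; exists (a * c)%CS; rewrite // -a_aca.
exists (x * c * y)%CS.
by rewrite !cstar_mulA bx_a -cstar_mulA yb_a.
Qed.

End CStarProduct.

Theorem proposition3p1 (R : realType) (A B : cstarAlgType R)
    (T : {linear A -> B}) (hT : jordan_star_homomorphism T) (a b : A)
    (ha : vN_regular a) (hb : vN_regular b) (hab : diamond_le a b) :
  diamond_le (T a) (T b).
Proof.
have [T_sqr T_adj] := hT.
have [w a_bwb] := regular_diamond_le_factor ha hab.
have Ta_bwb : T a = (T b * T w * T b)%CS by rewrite a_bwb jordan_triple.
have [_ _ aaa_aba] := hab.
split.
- move=> _ [z _ <-]; exists (T w * T b * z)%CS => //.
  by rewrite Ta_bwb !cstar_mulA.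
- move=> _ [z _ <-]; exists (z * (T b * T w))%CS => //.
  by rewrite Ta_bwb !cstar_mulA.
- by rewrite -!T_adj -!jordan_triple // aaa_aba.
Qed.
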